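(* Let $\mathbb k$ be a field of characteristic $0$ and let $(A_U,\mu)\xrightarrow{\ \phi\ }(A_W,\xi)\xleftarrow{\ \psi\ }(A_V,\nu)$ be a diagram $\mathbb A$ of associative $\mathbb k$-algebras over the category $U\leftarrow W\to V$. With the notation of the context, the cochain complex underlying the L$_\infty[1]$ algebra $(\widetilde{\mathfrak g}[1]\oplus\mathfrak a)^{P_\Phi}_M$ (i.e. the graded vector space $\widetilde{\mathfrak g}[1]\oplus\mathfrak a$ with its unary bracket as differential) coincides with the truncated reduced Gerstenhaber–Schack complex $\mathrm C^{\bullet}_{\mathrm{GS}}(\mathbb A)$: one has $(\widetilde{\mathfrak g}[1]\oplus\mathfrak a)^{N-2}=\mathrm C^N_{\mathrm{GS}}(\mathbb A)$ for all $N$, and under this identification the unary bracket is $(-1)^N d_{\mathrm{GS}}$ on $\mathrm C^N_{\mathrm{GS}}(\mathbb A)$. Explicitly, $$\langle x[1]\oplus a\rangle=(-1)^{|x|+1}(d_{\mathrm H}x)[1]\ \oplus\ \big(d_\Delta x+(-1)^{|a|}d_{\mathrm H}a\big)\in\widetilde{\mathfrak g}[1]\oplus\mathfrak a$$ for homogeneous elements $x\in\widetilde{\mathfrak g}$ and $a\in\mathfrak a$, of degrees $|x|$ and $|a|$.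
   Context: All $\operatorname{Hom}$ and $\otimes$ are over $\mathbb k$; being a diagram means $\mu,\nu,\xi$ are associative multiplications and $\phi,\psi$ are linear maps respecting them. Put $\mathfrak g=\prod_{n\ge 0}\mathfrak g^n$, $\widetilde{\mathfrak g}=\prod_{n\ge0}\widetilde{\mathfrak g}^n$, $\mathfrak a=\prod_{n\ge0}\mathfrak a^n$ with $$\mathfrak g^n=\bigoplus_{(T_0,\dots,T_n)\in\{U,V,W\}^{n+1}}\operatorname{Hom}(A_{T_0}\otimes\cdots\otimes A_{T_n},A_W)\ \oplus\ \operatorname{Hom}(A_U^{\otimes n+1},A_U)\ \oplus\ \operatorname{Hom}(A_V^{\otimes n+1},A_V),$$ $$\widetilde{\mathfrak g}^n=\operatorname{Hom}(A_U^{\otimes n+1},A_U)\oplus\operatorname{Hom}(A_V^{\otimes n+1},A_V)\oplus\operatorname{Hom}(A_W^{\otimes n+1},A_W),$$ $$\mathfrak a^n=\operatorname{Hom}(A_U^{\otimes n+1},A_W)\oplus\operatorname{Hom}(A_V^{\otimes n+1},A_W).$$ Both $\widetilde{\mathfrak g}$ and $\mathfrak a$ lie in $\mathfrak g$; $P\colon\mathfrak g\to\mathfrak a$ is the projection given by the direct sum decomposition of $\mathfrak g^n$. Set $M=\mu\oplus\nu\oplus\xi\in\widetilde{\mathfrak g}^1$ and $\Phi=\phi\oplus\psi\in\mathfrak a^0$. Gerstenhaber bracket on $\mathfrak g$: for homogeneous multilinear maps $f$ (degree $m$, i.e. $m+1$ inputs) and $g$ (degree $n$, i.e. $n+1$ inputs),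 $f\circ_i g=f(\mathrm{id}^{\otimes i}\otimes g\otimes\mathrm{id}^{\otimes m-i})$ for $0\le i\le m$, understood to be $0$ if the target of $g$ is not the algebra that is the $i$-th input (counting from $0$) of $f$; $f\circ g=\sum_{i=0}^m(-1)^{ni}f\circ_i g$; and $[f,g]=f\circ g-(-1)^{mn}g\circ f$. $P_\Phi(x)=P\big(x+[x,\Phi]+\tfrac12[[x,\Phi],\Phi]+\cdots\big)$ (a finite sum on homogeneous $x$). In $\widetilde{\mathfrak g}[1]\oplus\mathfrak a$ the element $x[1]$ has degree $|x|-1$. The unary bracket of $(\widetilde{\mathfrak g}[1]\oplus\mathfrak a)^{P_\Phi}_M$ is $$\langle x[1]\oplus a\rangle=-[M,x][1]\oplus P_\Phi(x+[M,a]).$$ Truncated reduced Gerstenhaber–Schack complex: $\mathrm C^{0,q}=\operatorname{Hom}(A_U^{\otimes q},A_U)\oplus\operatorname{Hom}(A_V^{\otimes q},A_V)\oplus\operatorname{Hom}(A_W^{\otimes q},A_W)$ and $\mathrm C^{1,q}=\operatorname{Hom}(A_U^{\otimes q},A_W)\oplus\operatorname{Hom}(A_V^{\otimes q},A_W)$ for $q\ge1$; all other $\mathrm C^{p,q}$ are $0$; $\mathrm C^N_{\mathrm{GS}}(\mathbb A)=\bigoplus_{p+q=N}\mathrm C^{p,q}$. The Hochschild differential $d_{\mathrm H}\colon\mathrm C^{p,q}\to\mathrm C^{p,q+1}$ is, on each component $\operatorname{Hom}(S^{\otimes q},B)$, $$d_{\mathrm H}(x)(s_0,\dots,s_q)=s_0\cdot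 x(s_1,\dots,s_q)+\sum_{i=1}^q(-1)^i x(s_0,\dots,s_{i-1}s_i,\dots,s_q)+(-1)^{q+1}x(s_0,\dots,s_{q-1})\cdot s_q,$$ where $A_W$ is regarded as an $A_U$-bimodule via $\phi$ and as an $A_V$-bimodule via $\psi$. The simplicial differential $d_\Delta\colon\mathrm C^{0,q}\to\mathrm C^{1,q}$ sends $x=(x_U,x_V,x_W)$ to $$d_\Delta x=\big(x_W\circ\phi^{\otimes q}-\phi\circ x_U,\ x_W\circ\psi^{\otimes q}-\psi\circ x_V\big),$$ and is zero on $\mathrm C^{1,q}$. The Gerstenhaber–Schack differential is $d_{\mathrm{GS}}=d_{\mathrm H}+(-1)^{q}d_\Delta$ on $\mathrm C^{p,q}$. *)

(* Defs.v *)
From HB Require Import structures.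
From mathcomp Require Import all_boot all_order all_algebra.
From mathcomp Require Import boolp classical_sets functions fsbigop.

Set Implicit Arguments.
Unset Strict Implicit.
Unset Printing Implicit Defensive.

Import GRing.Theory.
Local Open Scope ring_scope.

(* Products of a family of vector spaces.  [fam V] also serves for a graded
   vector space [V : nat -> lmodType K]: its degree [n] part consists of the
   elements that are [homog] of degree [n], and is zero in negative degrees. *)
Section Fam.
Variables (K : fieldType) (I : Type) (V : I -> lmodType K).

Definition fam := forall i, V i.

HB.instance Definition _ := gen_eqMixin fam.
HB.instance Definition _ := gen_choiceMixin fam.

Let fadd (f g : fam) : fam := fun i => f i + g i.
Let fzero : fam := fun i => 0.
Let fopp (f : fam) : fam := fun i => - f i.
Let fscale (c : K) (f : fam) : fam := fun i => c *: f i.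

Let faddA : associative fadd.
Proof. by move=> f g h; apply: functional_extensionality_dep => i; exact: addrA. Qed.
Let faddC : commutative fadd.
Proof. by move=> f g; apply: functional_extensionality_dep => i; exact: addrC. Qed.
Let fadd0 : left_id fzero fadd.
Proof. by move=> f; apply: functional_extensionality_dep => i; exact: add0r. Qed.
Let faddN : left_inverse fzero fopp fadd.
Proof. by move=> f; apply: functional_extensionality_dep => i; exact: addNr. Qed.

HB.instance Definition _ := GRing.isZmodule.Build fam faddA faddC fadd0 faddN.

Let fscaleA (a b : K) f : fscale a (fscale b f) = fscale (a * b) f.
Proof. by apply: functional_extensionality_dep => i; exact: scalerA. Qed.
Let fscale1 : left_id 1 fscale.
Proof. by move=> f; apply: functional_extensionality_dep => i; exact: scale1r. Qed.
Let fscaleDr : right_distributive fscale +%R.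
Proof. by move=> a f g; apply: functional_extensionality_dep => i; exact: scalerDr. Qed.
Let fscaleDl f : {morph fscale^~ f : a b / a + b}.
Proof. by move=> a b; apply: functional_extensionality_dep => i; exact: scalerDl. Qed.

HB.instance Definition _ := GRing.Zmodule_isLmodule.Build K fam
  fscaleA fscale1 fscaleDr fscaleDl.

End Fam.

Definition homog (K : fieldType) (V : nat -> lmodType K) (d : int) (x : fam V) : Prop :=
  forall n : nat, n%:Z <> d -> x n = 0.

Variant obj := objU | objV | objW.

(* Algebras are not assumed unital. *)
Record diagram (K : fieldType) := Diagram {
  alg :> obj -> lmodType K;
  amul : forall t, {bilinear alg t -> alg t -> alg t};
  amulA : forall t, associative (amul t);
  phi : {linear alg objU -> alg objW};
  phiM : {morph phi : x y / amul objU x y >-> amul objW x y};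
  psi : {linear alg objV -> alg objW};
  psiM : {morph psi : x y / amul objV x y >-> amul objW x y}
}.

Arguments amul {K d} t.
Arguments phi {K d}.
Arguments psi {K d}.

Section Multilinear.
Variables (K : fieldType) (A : diagram K).

Definition word n := 'I_n -> obj.

Definition args n (w : word n) := forall i, A (w i).

Definition multilinear n (w : word n) t (f : args w -> A t) : Prop :=
  forall (i : 'I_n) (c : K) (x y z : args w),
    z i = c *: x i + y i ->
    (forall j, j != i -> x j = z j /\ y j = z j) ->
    f z = c *: f x + f y.

Definition is_mlin n (w : word n) t (f : args w -> A t) : bool :=
  `[< multilinear f >].

(* [mlin w t] is Hom(A_(w 0) (x) ... (x) A_(w (n-1)), A_t). *)
Record mlin n (w : word n) t :=
  Mlin { mfun :> args w -> A t; mfunP : is_mlin mfun }.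

Lemma is_mlin_closed n (w : word n) t : submod_closed (@is_mlin n w t).
Proof.
split=> [|c f g /asboolP fP /asboolP gP]; apply/asboolP.
  by move=> i c x y z _ _; rewrite /= scaler0 addr0.
move=> i d x y z zE E.
have cfgE a : (c *: f + g) a = c *: f a + g a by [].
rewrite !cfgE (fP i d x y z) // (gP i d x y z) //.
by rewrite !scalerDr !scalerA (mulrC c d) addrACA.
Qed.

HB.instance Definition _ n (w : word n) t :=
  GRing.isSubmodClosed.Build K (args w -> A t) (@is_mlin n w t)
    (is_mlin_closed w t).
HB.instance Definition _ n (w : word n) t :=
  [isSub for @mfun n w t : mlin w t -> args w -> A t].
HB.instance Definition _ n (w : word n) t := [Choice of mlin w t by <:].
HB.instance Definition _ n (w : word n) t :=
  [SubChoice_isSubLmodule of mlin w t by <:].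

Definition mkMlin n (w : word n) t (f : args w -> A t) (fP : multilinear f) :
  mlin w t := Mlin (asboolT fP).

Lemma mlinP n (w : word n) t (f : mlin w t) : multilinear f.
Proof. exact/asboolP/mfunP. Qed.

(* Usable form of the hypotheses of [multilinear], free of dependent rewriting. *)
Lemma multilinear_sub n (w : word n) (i : 'I_n) (c : K) (x y z : args w) :
    z i = c *: x i + y i -> (forall j, j != i -> x j = z j /\ y j = z j) ->
  forall j, if j == i then z j = c *: x j + y j else x j = z j /\ y j = z j.
Proof. by move=> zE E j; case: eqVneq => [->|/E]. Qed.

Lemma argsP n (w : word n) (x y : args w) : (forall i, x i = y i) -> x = y.
Proof. exact: functional_extensionality_dep. Qed.

Definition Hom n s t : lmodType K := mlin (fun _ : 'I_n => s) t.

End Multilinear.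

Arguments mlin {K} A {n} w t.
Arguments Hom {K} A n s t.


Section Components.
Variables (K : fieldType) (A : diagram K).

(* Extension by zero: the identity of [A s] if [s] and [t] are the same. *)
Definition ext0 (s t : obj) : A s -> A t :=
  match s, t return A s -> A t with
  | objU, objU | objV, objV | objW, objW => id
  | _, _ => fun => 0
  end.

Lemma ext0P s t (c : K) (x y : A s) : ext0 t (c *: x + y) = c *: ext0 t x + ext0 t y.
Proof. by case: s x y; case: t => x y //=; rewrite scaler0 addr0. Qed.

(* For n > 0, [f] seen at the component [w]: zero unless [w] is constantly [s]. *)
Lemma spread_subproof n s t (f : Hom A n s t) (w : word n) :
  multilinear (fun a : args A w => mfun f (fun i => ext0 s (a i))).
Proof.
move=> i c x y z zE E; apply: (@mlinP _ _ _ _ _ f (i)).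
  by rewrite zE ext0P.
by move=> j /E[-> ->].
Qed.
Definition spread n s t (f : Hom A n s t) (w : word n) : mlin A w t :=
  mkMlin (@spread_subproof n s t f w).

Lemma comp_hom_subproof n s t u (h : {linear A s -> A t}) (f : Hom A n t u) :
  multilinear (fun a : args A (fun _ : 'I_n => s) => mfun f (fun i => h (a i))).
Proof.
move=> i c x y z zE E; apply: (@mlinP _ _ _ _ _ f (i)).
  by rewrite zE linearP.
by move=> j /E[-> ->].
Qed.
(* f o h^{(x) n} *)
Definition comp_hom n s t u (f : Hom A n t u) (h : {linear A s -> A t}) :
  Hom A n s u := mkMlin (@comp_hom_subproof n s t u h f).

Lemma hom_comp_subproof n s t u (h : {linear A t -> A u}) (f : Hom A n s t) :
  multilinear (fun a => h (mfun f a)).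
Proof. by move=> i c x y z zE E; rewrite (mlinP f zE E) linearP. Qed.
(* h o f *)
Definition hom_comp n s t u (h : {linear A t -> A u}) (f : Hom A n s t) :
  Hom A n s u := mkMlin (@hom_comp_subproof n s t u h f).

Lemma mul_hom_subproof t :
  multilinear (fun a : args A (fun _ : 'I_2 => t) => amul t (a ord0) (a ord_max)).
Proof.
move=> i c x y z zE E.
case: (eqVneq i ord0) => [i0|ni].
  have [|xE yE] := E ord_max; first by rewrite i0.
  by rewrite xE yE -i0 zE linearPl.
have iE : i = ord_max by apply/val_inj; case: i ni {zE E} => [[|[|]]].
have [|xE yE] := E ord0; first by rewrite iE.
by rewrite xE yE -iE zE linearPr.
Qed.
Definition mul_hom t : Hom A 2 t t := mkMlin (@mul_hom_subproof t).

Lemma lin_hom_subproof s t (h : {linear A s -> A t}) :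
  multilinear (fun a : args A (fun _ : 'I_1 => s) => h (a ord0)).
Proof. by move=> i c x y z zE E; rewrite (ord1 i) in zE; rewrite zE linearP. Qed.
Definition lin_hom s t (h : {linear A s -> A t}) : Hom A 1 s t :=
  mkMlin (@lin_hom_subproof s t h).

End Components.

Section Insertion.
Variables (K : fieldType) (A : diagram K).

(* Cutting a word (resp. a list of arguments) of length k+1 = m+n+1 for an
   insertion at place i: the inner word consists of the letters i, ..., i+n,
   and the outer word of length m+1 has a letter s in their place. *)
Definition inner k n (w : word k.+1) (i : nat) : word n.+1 :=
  fun j => w (inord (i + j)).

Definition outer k m n (w : word k.+1) (i : 'I_m.+1) (s : obj) : word m.+1 :=
  fun j => if (j < i)%N then w (inord j) else
           if j == i then s else w (inord (j + n)).

Arguments inner {k} n w i.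
Arguments outer {k m} n w i s.

Definition inner_args k n (w : word k.+1) i (x : args A w) :
    args A (inner n w i) :=
  fun j => x (inord (i + j)).

Definition outer_args k m n (w : word k.+1) (i : 'I_m.+1) s (x : args A w)
    (y : A s) : args A (outer n w i s) :=
  fun j => match (j < i)%N as b return
    A (if b then w (inord j) else if j == i then s else w (inord (j + n)))
  with
  | true => x (inord j)
  | false => match j == i as b return A (if b then s else w (inord (j + n))) with
             | true => y
             | false => x (inord (j + n))
             end
  end.

Arguments inner_args {k n w} i x.
Arguments outer_args {k m n w i s} x y.

Lemma insert_subproof k m n (e : (m + n = k)%N) (w : word k.+1) (i : 'I_m.+1)
    s t (f : mlin A (outer n w i s) t) (g : mlin A (inner n w i) s) :
  multilinear (fun x => mfun f (outer_args x (mfun g (inner_args i x)))).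
Proof.
subst k => l c x y z zE E.
have Z := multilinear_sub zE E.
have iE (j : 'I_n.+1) : (inord (i + j) : 'I_(m + n).+1) = (i + j)%N :> nat.
  by rewrite inordK // ltnS leq_add // -ltnS.
have oE (j : 'I_m.+1) : (inord j : 'I_(m + n).+1) = j :> nat.
  by rewrite inordK // (leq_trans (ltn_ord j)) // ltnS leq_addr.
have oE' (j : 'I_m.+1) : (inord (j + n) : 'I_(m + n).+1) = (j + n)%N :> nat.
  by rewrite inordK // ltnS leq_add2r -ltnS.
have [/andP[il li]|nil] := boolP ((i <= l) && (l <= i + n))%N.
  have lt : (l - i < n.+1)%N by rewrite ltnS leq_subLR.
  have lE : inord (i + Ordinal lt) = l.
    by apply: ord_inj; rewrite iE /= subnKC.
  have -> : mfun g (inner_args i z) =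
      c *: mfun g (inner_args i x) + mfun g (inner_args i y).
    apply: (@mlinP _ _ _ _ _ g (Ordinal lt)); rewrite /inner_args.
      by move: (Z (inord (i + Ordinal lt))); rewrite {1}lE eqxx.
    move=> j jl; move: (Z (inord (i + j))); case: eqP => [|//] jlE.
    move/eqP: jl; case; apply/val_inj => /=.
    by rewrite -jlE iE addKn.
  apply: (@mlinP _ _ _ _ _ f (i)); rewrite /outer_args /outer.
    by move: (ltnn i) (eqxx i); case: (i < i)%N => // _; case: (i == i).
  move=> j ji; move: (Z (inord j)) (Z (inord (j + n))) (negbTE ji).
  move: (ltnP j i); case: (j < i)%N => jiP.
    case: eqP => [jl|_ [-> ->] //].
    by move: il; rewrite -jl oE leqNgt; inversion jiP as [H|H]; rewrite H.
  case: (j == i) => // _.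
  case: eqP => [jl|_ [-> ->] //].
  move: li; rewrite -jl oE' leq_add2r => ji'; case/eqP: ji; apply/val_inj/eqP.
  by rewrite eqn_leq ji' /=; inversion jiP.
have gE u : (forall q : 'I_(m + n).+1, q != l -> u q = z q) ->
    mfun g (inner_args i u) = mfun g (inner_args i z).
  move=> uz; congr (mfun g _); apply: argsP => j; rewrite /inner_args; apply: uz.
  apply: contra nil => /eqP <-; rewrite iE leq_addr leq_add2l.
  exact: (ltn_ord j).
rewrite (gE x) => [|q /E[]//]; rewrite (gE y) => [|q /E[]//].
set u := mfun g _; clearbody u.
have [li|il] := ltnP l i.
  have lt : (l < m.+1)%N by apply: ltn_trans li _.
  have lE : inord (Ordinal lt) = l by apply: ord_inj; rewrite oE.
  apply: (@mlinP _ _ _ _ _ f (Ordinal lt)); rewrite /outer_args /outer.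
    move: (Z (inord (Ordinal lt))); rewrite {1}lE eqxx.
    have : (Ordinal lt < i)%N by [].
    by case: (Ordinal lt < i)%N.
  move=> j jl; move: (Z (inord j)) (Z (inord (j + n))).
  case: (ltnP j i) => [ji|ij].
    case: eqP => [jlE|//]; case/eqP: jl; apply/val_inj => /=.
    by rewrite -jlE oE.
  case: (j == i) => // _; case: eqP => [jlE|//].
  by move: li; rewrite -jlE oE' ltnNge (leq_trans ij) // leq_addr.
move: nil; rewrite il /= -ltnNge => lin.
have lt : (l - n < m.+1)%N.
  by rewrite ltnS leq_subLR [(n + m)%N]addnC -ltnS.
have nl : (n <= l)%N by rewrite (leq_trans (leq_addl i n) (ltnW lin)).
have lE : inord (Ordinal lt + n) = l by apply: ord_inj; rewrite oE' /= subnK.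
have iln : (i < l - n)%N by rewrite ltn_subRL addnC.
apply: (@mlinP _ _ _ _ _ f (Ordinal lt)); rewrite /outer_args /outer.
  move: (Z (inord (Ordinal lt + n))); rewrite {1}lE eqxx.
  have : (Ordinal lt < i)%N = false by rewrite ltnNge (ltnW iln).
  case: (Ordinal lt < i)%N => // _.
  have : (Ordinal lt == i) = false by apply/eqP=> eE; rewrite -eE ltnn in iln.
  by case: (Ordinal lt == i).
move=> j jl; move: (Z (inord j)) (Z (inord (j + n))).
case: (ltnP j i) => [ji|ij].
  case: eqP => [jlE|//].
  by move: il; rewrite -jlE oE leqNgt ji.
case: (j == i) => // _; case: eqP => [jlE|//].
by case/eqP: jl; apply: ord_inj; rewrite /= -jlE oE' addnK.
Qed.

(* f (id^{(x) i} (x) g (x) id^{(x) (m - i)}) *)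
Definition insert k m n (e : (m + n = k)%N) (w : word k.+1) (i : 'I_m.+1) s t
    (f : mlin A (outer n w i s) t) (g : mlin A (inner n w i) s) : mlin A w t :=
  mkMlin (@insert_subproof k m n e w i s t f g).

End Insertion.

Arguments inner {k} n w i.
Arguments outer {k m} n w i s.
Arguments insert {K A k m n} e {w i s t} f g.

Section Gerstenhaber.
Variables (K : fieldType) (A : diagram K).

(* The summands Hom(A_(T_0) (x) ... (x) A_(T_n), A_W) are indexed by words. *)
Definition g_ (n : nat) : lmodType K :=
  (fam (fun w : word n.+1 => mlin A w objW)
   * Hom A n.+1 objU objU * Hom A n.+1 objV objV)%type.

Definition gt_ (n : nat) : lmodType K :=
  (Hom A n.+1 objU objU * Hom A n.+1 objV objV * Hom A n.+1 objW objW)%type.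

Definition a_ (n : nat) : lmodType K :=
  (Hom A n.+1 objU objW * Hom A n.+1 objV objW)%type.

Definition gt_in_g n (x : gt_ n) : g_ n :=
  (fun w => spread x.2 w, x.1.1, x.1.2).

Definition a_in_g n (a : a_ n) : g_ n :=
  (fun w => spread a.1 w + spread a.2 w, 0, 0).

Definition proj_a n (f : g_ n) : a_ n :=
  (f.1.1 (fun=> objU), f.1.1 (fun=> objV)).

Definition component n (f : g_ n) (w : word n.+1) t : mlin A w t :=
  match t with
  | objU => spread f.1.2 w
  | objV => spread f.2 w
  | objW => f.1.1 w
  end.

(* The (w, t) component of f o_i g.  The sum is over the possible targets of
   the inserted component of g; [component] is 0 for the pairs (w, t) that do
   not occur in g_.  The equation e lets f o g and g o f, of degrees m + n and
   n + m, have the same type. *)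
Definition circ_at m n k (e : (m + n = k)%N) (f : g_ m) (g : g_ n)
    (i : 'I_m.+1) (w : word k.+1) t : mlin A w t :=
  \sum_(s <- [:: objU; objV; objW])
    insert e (component f (outer n w i s) t) (component g (inner n w i) s).

Definition circ m n k (e : (m + n = k)%N) (f : g_ m) (g : g_ n) : g_ k :=
  let c w t := \sum_(i < m.+1) (-1) ^+ (n * i) *: circ_at e f g i w t in
  (fun w => c w objW, c (fun=> objU) objU, c (fun=> objV) objV).

Definition bracket_ m n k (e : (m + n = k)%N) (f : g_ m) (g : g_ n) : g_ k :=
  circ e f g - (-1) ^+ (m * n) *: circ (etrans (addnC n m) e) g f.

Definition bracket (f g : fam g_) : fam g_ := fun k =>
  \sum_(m < k.+1) bracket_ (subnKC (leq_ord m)) (f m) (g (k - m)%N).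

Definition of_gt (x : fam gt_) : fam g_ := fun n => gt_in_g (x n).
Definition of_a (a : fam a_) : fam g_ := fun n => a_in_g (a n).
Definition P (f : fam g_) : fam a_ := fun n => proj_a (f n).

Definition M : fam gt_ := fun n =>
  match n with
  | 1 => (mul_hom A objU, mul_hom A objV, mul_hom A objW)
  | _ => 0
  end.

Definition Phi : fam a_ := fun n =>
  match n with
  | 0 => (lin_hom phi, lin_hom psi)
  | _ => 0
  end.

Definition adPhi (f : fam g_) : fam g_ := bracket f (of_a Phi).

(* The sum over all j is taken degree by degree; in degree n only finitely many
   terms are nonzero. *)
Definition expPhi (f : fam g_) : fam g_ := fun n =>
  \sum_(j \in [set: nat]%classic) (j`!%:R : K)^-1 *: iter j adPhi f n.

Definition P_Phi (f : fam g_) : fam a_ := P (expPhi f).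

(* The shift [1] only affects degrees: the first factor is gt_ with its elements
   of degree d + 1 put in degree d. *)
Definition L : lmodType K := (fam gt_ * fam a_)%type.

Definition L_deg (d : int) (l : L) : Prop := homog (d + 1) l.1 /\ homog d l.2.

(* The formula takes values in g[1] + a, which contains L = g~[1] + a through
   [L_in]; that the bracket [M, x] stays in g~ is not built in here. *)
Definition unary (l : L) : fam g_ * fam a_ :=
  (- bracket (of_gt M) (of_gt l.1), P_Phi (of_gt l.1 + bracket (of_gt M) (of_a l.2))).

Definition L_in (l : L) : fam g_ * fam a_ := (of_gt l.1, l.2).

End Gerstenhaber.

Section Hochschild.
Variables (K : fieldType) (A : diagram K) (s t : obj) (h : {linear A s -> A t}).

Definition cargs q := args A (fun _ : 'I_q => s).

Definition contract q (i : 'I_q) (a : cargs q.+1) : cargs q := fun j =>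
  if (j < i)%N then a (widen_ord (leqnSn q) j)
  else if j == i then amul s (a (widen_ord (leqnSn q) i)) (a (lift ord0 i))
  else a (lift ord0 j).

Definition atail q (a : cargs q.+1) : cargs q := fun j => a (lift ord0 j).
Definition ainit q (a : cargs q.+1) : cargs q := fun j => a (widen_ord (leqnSn q) j).

Lemma hoch_l_subproof q (x : Hom A q s t) :
  multilinear (fun a : cargs q.+1 => amul t (h (a ord0)) (mfun x (atail a))).
Proof.
move=> i c u v z zE E; have [i0|i0] := eqVneq i ord0.
  subst i; have zu : atail z = atail u.
    by apply: argsP => j; rewrite /atail; case: (E (lift ord0 j)).
  have -> : atail v = atail u.
    by rewrite -zu; apply: argsP => j; rewrite /atail; case: (E (lift ord0 j)).
  by rewrite zu zE linearP linearPl.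
have [j ji] : exists j, i = lift ord0 j.
  by case: (unliftP ord0 i) i0 => [j ->|->]; [exists j|rewrite eqxx].
have [|-> ->] := E ord0; first by rewrite eq_sym.
have -> : mfun x (atail z) = c *: mfun x (atail u) + mfun x (atail v).
  apply: (@mlinP _ _ _ _ _ x j); rewrite /atail -?ji //.
  by move=> l lj; apply: E; rewrite ji (inj_eq lift_inj).
by rewrite linearPr.
Qed.

Lemma hoch_r_subproof q (x : Hom A q s t) :
  multilinear (fun a : cargs q.+1 => amul t (mfun x (ainit a)) (h (a ord_max))).
Proof.
have wl (j : 'I_q) : widen_ord (leqnSn q) j != ord_max.
  by apply/eqP => /(congr1 val) /= jq; have := ltn_ord j; rewrite jq ltnn.
move=> i c u v z zE E; have [i0|i0] := eqVneq i ord_max.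
  subst i; have zu : ainit z = ainit u.
    by apply: argsP => j; rewrite /ainit; case: (E _ (wl j)).
  have -> : ainit v = ainit u.
    by rewrite -zu; apply: argsP => j; rewrite /ainit; case: (E _ (wl j)).
  by rewrite zu zE linearP linearPr.
have iq : (i < q)%N.
  rewrite ltn_neqAle -ltnS ltn_ord andbT.
  by apply: contra i0 => /eqP iq; apply/eqP/ord_inj.
have ji : i = widen_ord (leqnSn q) (Ordinal iq) by apply: ord_inj.
have [|-> ->] := E ord_max; first by rewrite eq_sym.
have -> : mfun x (ainit z) = c *: mfun x (ainit u) + mfun x (ainit v).
  apply: (@mlinP _ _ _ _ _ x (Ordinal iq)); rewrite /ainit -?ji //.
  move=> l lj; apply: E; apply: contra lj => /eqP li; apply/eqP/ord_inj.
  by rewrite /= -li.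
by rewrite linearPl.
Qed.

Lemma hoch_m_subproof q (i : 'I_q) (x : Hom A q s t) :
  multilinear (fun a : cargs q.+1 => mfun x (contract i a)).
Proof.
move=> l c u v z zE E.
pose wd := widen_ord (leqnSn q).
have [li|il] := ltnP l i.
  have lq : (l < q)%N by apply: ltn_trans li _.
  have lE : wd (Ordinal lq) = l by apply: ord_inj.
  apply: (@mlinP _ _ _ _ _ x (Ordinal lq)) => [|j jl]; rewrite /contract /=.
    by rewrite li -/wd lE.
  have wj : wd j != l.
    by apply: contra jl => /eqP wjE; apply/eqP/ord_inj; rewrite /= -wjE.
  case: ltnP => [_|ij]; first exact: E.
  have lj : lift ord0 j != l.
    by apply/eqP => ljE; move: li; rewrite -ljE ltnNge lift0 (leq_trans ij).
  case: eqP => [ji|_]; last exact: E.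
  subst j; case: (E _ wj) => -> ->; case: (E _ lj) => -> -> //.
have [il1|il1] := ltnP i.+1 l.
  have lq : (l.-1 < q)%N by case: (nat_of_ord l) (ltn_ord l) il1.
  have l0 : (0 < l)%N by apply: leq_trans il1.
  have lE : lift ord0 (Ordinal lq) = l by apply: ord_inj; rewrite lift0 /= prednK.
  have iln : (i < l.-1)%N by rewrite -ltnS prednK.
  apply: (@mlinP _ _ _ _ _ x (Ordinal lq)) => [|j jl]; rewrite /contract /=.
    rewrite ltnNge (ltnW iln) /=; case: eqP => [iE|_]; last by rewrite lE.
    by move: iln; rewrite -iE /= ltnn.
  have lj : lift ord0 j != l.
    by apply: contra jl => /eqP jl; apply/eqP/ord_inj; rewrite /= -jl lift0.
  case: ltnP => [ji|ij].
    apply: E; apply/eqP => jE; move: iln.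
    by rewrite -jE /= ltnNge (leq_trans (leq_pred _) (ltnW ji)).
  case: eqP => [ji|_]; last exact: E.
  subst j; case: (E _ lj) => -> ->; case: (E (wd i)) => [|-> -> //].
  by apply/eqP => wE; move: il1; rewrite -wE /= ltnNge leqnSn.
have wj (j : 'I_q) : (j < i)%N -> wd j != l.
  by move=> ji; apply/eqP => jE; move: il; rewrite -jE leqNgt ji.
have lj (j : 'I_q) : (i < j)%N -> lift ord0 j != l.
  by move=> ij; apply/eqP => jE; move: il1; rewrite -jE lift0 ltnS leqNgt ij.
apply: (@mlinP _ _ _ _ _ x i) => [|j ji]; rewrite /contract.
  rewrite ltnn eqxx -/wd; have [li|li] := eqVneq (wd i) l.
    have [|-> ->] := E (lift ord0 i).
      by rewrite -li; apply/eqP => /(congr1 val) /= /eqP; rewrite /bump /= add1n gtn_eqF.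
    by rewrite li zE linearPl.
  have lE : lift ord0 i = l.
    apply: ord_inj; rewrite lift0; apply/eqP; rewrite eqn_leq il1 andbT.
    rewrite ltn_neqAle il andbT; apply: contra li => /eqP iE.
    by apply/eqP/ord_inj.
  have [|-> ->] := E (wd i) => //.
  by rewrite lE zE linearPr.
case: ltnP => [ji'|ij]; first by apply: E; exact: wj.
rewrite (negbTE ji); apply: E; apply: lj.
by rewrite ltn_neqAle ij andbT eq_sym.
Qed.

Definition hoch_l q (x : Hom A q s t) : Hom A q.+1 s t :=
  mkMlin (@hoch_l_subproof q x).
Definition hoch_m q (i : 'I_q) (x : Hom A q s t) : Hom A q.+1 s t :=
  mkMlin (@hoch_m_subproof q i x).
Definition hoch_r q (x : Hom A q s t) : Hom A q.+1 s t :=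
  mkMlin (@hoch_r_subproof q x).

(* [A t] is an [A s]-bimodule via [h].  The products s_(i-1) s_i of the formula,
   1 <= i <= q, are numbered from 0 here. *)
Definition hoch q (x : Hom A q s t) : Hom A q.+1 s t :=
  hoch_l x + \sum_(i < q) (-1) ^+ i.+1 *: hoch_m i x + (-1) ^+ q.+1 *: hoch_r x.

End Hochschild.

Arguments hoch {K A s t} h {q} x.

Section GerstenhaberSchack.
Variables (K : fieldType) (A : diagram K).

Definition zmod0 : lmodType K := 'rV[K]_0.

Definition C (p q : nat) : lmodType K :=
  match p, q with
  | 0, q'.+1 => (Hom A q objU objU * Hom A q objV objV * Hom A q objW objW)%type
  | 1, q'.+1 => (Hom A q objU objW * Hom A q objV objW)%type
  | _, _ => zmod0
  end.

Definition dH (p q : nat) : C p q -> C p q.+1 :=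
  match p, q return C p q -> C p q.+1 with
  | 0, q'.+1 => fun x => (hoch idfun x.1.1, hoch idfun x.1.2, hoch idfun x.2)
  | 1, q'.+1 => fun x => (hoch phi x.1, hoch psi x.2)
  | _, _ => fun=> 0
  end.

Definition dDelta (p q : nat) : C p q -> C p.+1 q :=
  match p, q return C p q -> C p.+1 q with
  | 0, q'.+1 => fun x => (comp_hom x.2 phi - hom_comp phi x.1.1,
                          comp_hom x.2 psi - hom_comp psi x.1.2)
  | _, _ => fun=> 0
  end.

Definition CGS : lmodType K := fam (fun p => fam (C p) : lmodType K).

Definition CGS_deg (N : int) (c : CGS) : Prop :=
  forall p q : nat, (p + q)%N%:Z <> N -> c p q = 0.

Definition dGS (c : CGS) : CGS := fun p q =>
  match q return C p q with 0 => 0 | q'.+1 => dH (c p q') end +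
  match p return C p q with 0 => 0 | p'.+1 => (-1) ^+ q *: dDelta (c p' q) end.

(* g~^n is C^{0,n+1} and a^n is C^{1,n+1}, on the nose. *)
Definition ident (c : CGS) : L A := (fun n => c 0%N n.+1, fun n => c 1%N n.+1).

Definition dH_gt (x : fam (gt_ A)) : fam (gt_ A) := fun n =>
  match n with 0 => 0 | n'.+1 => dH (x n' : C 0 n'.+1) end.

Definition dH_a (a : fam (a_ A)) : fam (a_ A) := fun n =>
  match n with 0 => 0 | n'.+1 => dH (a n' : C 1 n'.+1) end.

Definition dDelta_gt (x : fam (gt_ A)) : fam (a_ A) := fun n =>
  dDelta (x n : C 0 n.+1).

End GerstenhaberSchack.

(* Main.v *)
Require Import Defs.
From mathcomp Require Import all_boot all_order all_algebra.
From mathcomp Require Import boolp classical_sets functions fsbigop.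
From mathcomp Require Import zify.

(** Everything is evaluated on arguments.  Bracketing with Phi replaces one
    argument y_i lying in A_U or A_V by its image in A_W, so only x_W survives
    iteration: the j-th iterate on a word with exactly j letters other than W is
    j! times x_W applied to the images of all arguments, and the factorial
    cancels against the exponential; the remaining part - Phi o x occurs only
    for j = 1.  Each term of [M, a] vanishes on words with two letters W, so
    only [M, a] and [[M, a], Phi] contribute: projected to words in U or V
    alone, the former gives the inner terms of the Hochschild differential, the
    latter its two outer terms, where the argument next to a in a product of A_W
    is replaced by its image under phi or psi. *)

Set Implicit Arguments.
Unset Strict Implicit.
Unset Printing Implicit Defensive.

Import GRing.Theory.
Local Open Scope ring_scope.

Arguments outer_args {K A k m n w i s} x y.
Arguments inner_args {K A k n w} i x.
Arguments spread {K A n s t} f w.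

(** * Evaluation of insertions and circle products on arguments *)

Section Evaluation.
Variables (K : fieldType) (A : diagram K).

Lemma mlin_ext n (w : word n) t (f g : mlin A w t) :
  (forall x, mfun f x = mfun g x) -> f = g.
Proof. by move=> fg; apply/val_inj/functional_extensionality_dep. Qed.

Lemma mlin0E n (w : word n) t x : mfun (0 : mlin A w t) x = 0.
Proof. by []. Qed.

Lemma mlinDE n (w : word n) t (f g : mlin A w t) x :
  mfun (f + g) x = mfun f x + mfun g x.
Proof. by []. Qed.

Lemma mlinNE n (w : word n) t (f : mlin A w t) x : mfun (- f) x = - mfun f x.
Proof. by []. Qed.

Lemma mlinZE n (w : word n) t c (f : mlin A w t) x :
  mfun (c *: f) x = c *: mfun f x.
Proof. by []. Qed.

Definition mlinE := (mlin0E, mlinDE, mlinNE, mlinZE).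

Lemma mlin_sumE n (w : word n) t I (r : seq I) (Q : pred I)
    (f : I -> mlin A w t) x :
  mfun (\sum_(i <- r | Q i) f i) x = \sum_(i <- r | Q i) mfun (f i) x.
Proof. by apply: (big_morph (fun g : mlin A w t => mfun g x)). Qed.

Lemma mlin_arg0 n (w : word n) t (f : mlin A w t) x i :
  x i = 0 -> mfun f x = 0.
Proof.
move=> xi0; rewrite (mlinP f (i := i) (c := -1) (x := x) (y := x)) //.
  by rewrite scaleN1r addNr.
by rewrite scaleN1r addNr xi0.
Qed.

Lemma ext0_id t (x : A t) : ext0 t x = x.
Proof. by case: t x. Qed.

Lemma ext0_neq s t (x : A s) : s <> t -> ext0 t x = 0.
Proof. by case: s x; case: t. Qed.

Lemma sum_obj (V : nmodType) (F : obj -> V) :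
  \sum_(s <- [:: objU; objV; objW]) F s = F objU + F objV + F objW.
Proof. by rewrite !big_cons big_nil addr0 addrA. Qed.

(** The type of [outer_args x y j] depends on the two tests that select the argument. A family [e]
    of maps into one fixed type [B] removes this dependence, so that an ordinary conditional
    suffices. *)
Lemma outer_argsE B (e : forall s, A s -> B) k m n (w : word k.+1)
    (i : 'I_m.+1) s (x : args A w) (y : A s) j :
  e _ (outer_args (n := n) (i := i) x y j) =
  if (j < i)%N then e _ (x (inord j)) else
  if j == i then e _ y else e _ (x (inord (j + n))).
Proof. by rewrite /outer_args /outer; case: (j < i)%N => //; case: (j == i). Qed.

Lemma outer_args_at0 k m n (w : word k.+1) (i : 'I_m.+1) s (x : args A w) :
  outer_args (n := n) (i := i) x (0 : A s) i = 0.
Proof.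
rewrite /outer_args /outer; move: (ltnn i) (eqxx i).
by case: (i < i)%N => // _; case: (i == i).
Qed.

Lemma outer0E k (w : word k.+1) (i : 'I_k.+1) s j :
  outer 0 w i s j = if j == i then s else w j.
Proof.
rewrite /outer; case: eqP => [->|_]; first by rewrite ltnn.
by rewrite addn0 inord_val if_same.
Qed.

Lemma outer_args0E B (e : forall s, A s -> B) k (w : word k.+1)
    (i : 'I_k.+1) s (x : args A w) (y : A s) j :
  e _ (outer_args (n := 0) (i := i) x y j) =
  if j == i then e _ y else e _ (x j).
Proof.
rewrite outer_argsE; case: eqP => [->|_]; first by rewrite ltnn.
by rewrite addn0 inord_val if_same.
Qed.

(** The degree 0 element Phi as a single map on all letters: [phi] on A_U, [psi] on A_V, zero on
    A_W. Adding the identity of A_W gives [toW]. *)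
Definition push s (a : A s) : A objW := phi (ext0 objU a) + psi (ext0 objV a).

Definition toW s (a : A s) : A objW := ext0 objW a + push a.

Lemma pushW (a : A objW) : push a = 0.
Proof. by rewrite /push /= !linear0 addr0. Qed.

Lemma pushU (a : A objU) : push a = phi a.
Proof. by rewrite /push /= linear0 addr0. Qed.

Lemma pushV (a : A objV) : push a = psi a.
Proof. by rewrite /push /= linear0 add0r. Qed.

Lemma push0 s (a : A s) : s = objW -> push a = 0.
Proof. by case: s a => // a _; exact: pushW. Qed.

Lemma toW_W (a : A objW) : toW a = a.
Proof. by rewrite /toW pushW addr0. Qed.

Lemma toW_push s (a : A s) : s <> objW -> toW a = push a.
Proof. by move=> sW; rewrite /toW ext0_neq // add0r. Qed.

Lemma spreadE n s t (f : Defs.Hom A n s t) (w : word n) x :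
  mfun (spread f w) x = mfun f (fun i => ext0 s (x i)).
Proof. by []. Qed.

Lemma spread_neq n s t (f : Defs.Hom A n s t) (w : word n) x i :
  w i <> s -> mfun (spread f w) x = 0.
Proof. by move=> wi; rewrite spreadE (@mlin_arg0 _ _ _ _ _ i) ?ext0_neq. Qed.

Lemma spread0 n s t (w : word n) : spread (0 : Defs.Hom A n s t) w = 0.
Proof. exact: mlin_ext. Qed.

Lemma insertE k m n (e : (m + n = k)%N) (w : word k.+1) (i : 'I_m.+1) s t
    (f : mlin A (outer n w i s) t) (g : mlin A (inner n w i) s) x :
  mfun (insert e f g) x = mfun f (outer_args x (mfun g (inner_args i x))).
Proof. by []. Qed.

Definition gt_part n (x : gt_ A n) t : Defs.Hom A n.+1 t t :=
  match t with objU => x.1.1 | objV => x.1.2 | objW => x.2 end.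

Definition a_part n (a : a_ A n) t : Defs.Hom A n.+1 t objW :=
  match t with objU => a.1 | objV => a.2 | objW => 0 end.

Lemma component_gt n (x : gt_ A n) w t :
  component (gt_in_g x) w t = spread (gt_part x t) w.
Proof. by case: t. Qed.

Lemma component_aW n (a : a_ A n) w :
  component (a_in_g a) w objW = spread a.1 w + spread a.2 w.
Proof. by []. Qed.

Lemma component_a0 n (a : a_ A n) w t : t <> objW ->
  component (a_in_g a) w t = 0.
Proof. by case: t => //= _; apply: spread0. Qed.

Lemma component0 n (w : word n.+1) t : component (0 : g_ A n) w t = 0.
Proof. by case: t => //=; exact: spread0. Qed.

Lemma circ_atE m n k (e : (m + n = k)%N) (f : g_ A m) (g : g_ A n)
    (i : 'I_m.+1) (w : word k.+1) t x :
  mfun (circ_at e f g i w t) x = \sum_(s <- [:: objU; objV; objW])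
    mfun (component f (outer n w i s) t)
      (outer_args x (mfun (component g (inner n w i) s) (inner_args i x))).
Proof. by rewrite mlin_sumE. Qed.

Lemma circ_at0l m n k (e : (m + n = k)%N) (g : g_ A n) i (w : word k.+1) t :
  circ_at e (0 : g_ A m) g i w t = 0.
Proof.
by apply: mlin_ext => x; rewrite circ_atE big1 // => s _; rewrite component0.
Qed.

Lemma circ_at0r m n k (e : (m + n = k)%N) (f : g_ A m) i (w : word k.+1) t :
  circ_at e f (0 : g_ A n) i w t = 0.
Proof.
apply: mlin_ext => x; rewrite circ_atE big1 // => s _.
by rewrite component0 mlin0E (@mlin_arg0 _ _ _ _ _ i) ?outer_args_at0.
Qed.

(** The local function of [circ], named so that its U, V and W components are handled by one
    statement for all targets [t]. *)
Definition circ_sum m n k (e : (m + n = k)%N) (f : g_ A m) (g : g_ A n)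
    (w : word k.+1) t : mlin A w t :=
  \sum_(i < m.+1) (-1) ^+ (n * i) *: circ_at e f g i w t.

Lemma circE m n k (e : (m + n = k)%N) (f : g_ A m) (g : g_ A n) :
  circ e f g = (fun w => circ_sum e f g w objW,
    circ_sum e f g (fun=> objU) objU, circ_sum e f g (fun=> objV) objV).
Proof. by []. Qed.

Lemma circ0l m n k (e : (m + n = k)%N) (g : g_ A n) :
  circ e (0 : g_ A m) g = 0.
Proof.
have c0 w t : circ_sum e 0 g w t = 0.
  by rewrite /circ_sum big1 // => i _; rewrite circ_at0l scaler0.
rewrite circE !c0; congr (_, _, _).
by apply: functional_extensionality_dep => w; rewrite c0.
Qed.

Lemma circ0r m n k (e : (m + n = k)%N) (f : g_ A m) :
  circ e f (0 : g_ A n) = 0.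
Proof.
have c0 w t : circ_sum e f 0 w t = 0.
  by rewrite /circ_sum big1 // => i _; rewrite circ_at0r scaler0.
rewrite circE !c0; congr (_, _, _).
by apply: functional_extensionality_dep => w; rewrite c0.
Qed.

Lemma bracket_0l m n k (e : (m + n = k)%N) (g : g_ A n) :
  bracket_ e (0 : g_ A m) g = 0.
Proof. by rewrite /bracket_ circ0l circ0r scaler0 subrr. Qed.

Lemma bracket_0r m n k (e : (m + n = k)%N) (f : g_ A m) :
  bracket_ e f (0 : g_ A n) = 0.
Proof. by rewrite /bracket_ circ0l circ0r scaler0 subrr. Qed.

Lemma gt_in_g0 n : gt_in_g (0 : gt_ A n) = 0.
Proof.
congr (_, _, _); apply: functional_extensionality_dep => w; exact: spread0.
Qed.

Lemma a_in_g0 n : a_in_g (0 : a_ A n) = 0.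
Proof.
congr (_, _, _); apply: functional_extensionality_dep => w.
by rewrite !spread0 addr0.
Qed.

End Evaluation.

(** * Brackets with M and the Hochschild differential *)

Section BracketM.
Variables (K : fieldType) (A : diagram K).

(** Even for a constant word, [outer] has the letter [s] everywhere only after its tests are
    resolved. Hence [spread], which changes the type of [f] but not its values. *)
Definition hom_insert m n k (e : (m + n = k)%N) s t (f : Defs.Hom A m.+1 s t)
    (g : Defs.Hom A n.+1 s s) (i : 'I_m.+1) : Defs.Hom A k.+1 s t :=
  insert e (spread f (outer n (fun=> s) i s)) (spread g (inner n (fun=> s) i)).

Lemma hom_insertE m n k (e : (m + n = k)%N) s t (f : Defs.Hom A m.+1 s t)
    (g : Defs.Hom A n.+1 s s) (i : 'I_m.+1) b :
  mfun (hom_insert e f g i) b = mfun f (fun j =>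
    if (j < i)%N then b (inord j) else
    if j == i then mfun g (fun l => b (inord (i + l))) else b (inord (j + n))).
Proof.
rewrite /hom_insert insertE !spreadE; congr (mfun f _).
apply: functional_extensionality_dep => j.
rewrite (outer_argsE (fun u => @ext0 K A u s)) !ext0_id; congr (if _ then _ else _).
congr (if _ then _ else _); congr (mfun g _).
by apply: functional_extensionality_dep => l; rewrite /inner_args ext0_id.
Qed.

Lemma insert_spread m n k (e : (m + n = k)%N) s t (f : Defs.Hom A m.+1 s t)
    (g : Defs.Hom A n.+1 s s) (i : 'I_m.+1) (w : word k.+1) :
  insert e (spread f (outer n w i s)) (spread g (inner n w i)) =
  spread (hom_insert e f g i) w.
Proof.
apply: mlin_ext => x; rewrite insertE !spreadE hom_insertE; congr (mfun f _).
apply: functional_extensionality_dep => j.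
by rewrite (outer_argsE (fun u => @ext0 K A u s)) ext0_id.
Qed.

Lemma insert_spread_neq m n k (e : (m + n = k)%N) s u t
    (f : Defs.Hom A m.+1 s t) (i : 'I_m.+1) (w : word k.+1)
    (g : mlin A (inner n w i) u) : u <> s ->
  insert e (spread f (outer n w i u)) g = 0.
Proof.
move=> us; apply: mlin_ext => x; rewrite insertE (@spread_neq _ _ _ _ _ _ _ _ i) //.
by rewrite /outer ltnn eqxx.
Qed.

Lemma insertDl m n k (e : (m + n = k)%N) s t (i : 'I_m.+1) (w : word k.+1)
    (f f' : mlin A (outer n w i s) t) (g : mlin A (inner n w i) s) :
  insert e (f + f') g = insert e f g + insert e f' g.
Proof. exact: mlin_ext. Qed.

Lemma spreadD n s t (w : word n) (f g : Defs.Hom A n s t) :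
  spread (f + g) w = spread f w + spread g w.
Proof. exact: mlin_ext. Qed.

Lemma spreadZ n s t (w : word n) c (f : Defs.Hom A n s t) :
  spread (c *: f) w = c *: spread f w.
Proof. exact: mlin_ext. Qed.

Lemma spread_sum n s t (w : word n) I (r : seq I) (f : I -> Defs.Hom A n s t) :
  spread (\sum_(i <- r) f i) w = \sum_(i <- r) spread (f i) w.
Proof.
by apply: (big_morph (fun g => spread g w)) => [g h|]; [exact: spreadD|exact: spread0].
Qed.

Lemma spread_id n s t (f : Defs.Hom A n s t) : spread f (fun=> s) = f.
Proof.
apply: mlin_ext => x; rewrite spreadE; congr (mfun f _).
by apply: functional_extensionality_dep => i; exact: ext0_id.
Qed.

(** A map of g~ takes all its inputs from its own target, so only the inserted component with target
    [t] contributes. *)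
Lemma circ_at_gt m n k (e : (m + n = k)%N) (f : gt_ A m) (g : gt_ A n) i
    (w : word k.+1) t :
  circ_at e (gt_in_g f) (gt_in_g g) i w t = spread (hom_insert e (gt_part f t) (gt_part g t) i) w.
Proof.
rewrite /circ_at -insert_spread sum_obj !component_gt.
case: t.
- by rewrite [X in _ + X + _]insert_spread_neq // [X in _ + X]insert_spread_neq // !addr0.
- by rewrite [X in X + _ + _]insert_spread_neq // [X in _ + X]insert_spread_neq // addr0 add0r.
- by rewrite [X in X + _ + _]insert_spread_neq // [X in _ + X + _]insert_spread_neq // !add0r.
Qed.

Definition hom_circ m n k (e : (m + n = k)%N) s t (f : Defs.Hom A m.+1 s t)
    (g : Defs.Hom A n.+1 s s) : Defs.Hom A k.+1 s t :=
  \sum_(i < m.+1) (-1) ^+ (n * i) *: hom_insert e f g i.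

Lemma circ_sum_gt m n k (e : (m + n = k)%N) (f : gt_ A m) (g : gt_ A n)
    (w : word k.+1) t :
  circ_sum e (gt_in_g f) (gt_in_g g) w t = spread (hom_circ e (gt_part f t) (gt_part g t)) w.
Proof.
rewrite /circ_sum /hom_circ spread_sum; apply: eq_bigr => i _.
by rewrite circ_at_gt spreadZ.
Qed.

Lemma hom_insert_mul q s t (f : Defs.Hom A q.+1 s t) (e : (q + 1 = q.+1)%N) i :
  hom_insert e f (mul_hom A s) i = hoch_m i f.
Proof.
apply: mlin_ext => b; rewrite hom_insertE /=; congr (mfun f _).
apply: functional_extensionality_dep => j; rewrite /contract.
have jE (l : 'I_q.+1) : inord l = widen_ord (leqnSn q.+1) l.
  by apply: ord_inj; rewrite inordK // ltnS ltnW.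
have lE (l : 'I_q.+1) : inord (l + 1) = lift ord0 l.
  by apply: ord_inj; rewrite lift0 addn1 inordK // ltnS.
by rewrite addn0 !jE !lE; case: (eqVneq j i) => [->|_].
Qed.

Lemma hom_circ_mulr q s t (f : Defs.Hom A q.+1 s t) (e : (q + 1 = q.+1)%N) :
  hom_circ e f (mul_hom A s) = \sum_(i < q.+1) (-1) ^+ i *: hoch_m i f.
Proof. by apply: eq_bigr => i _; rewrite hom_insert_mul mul1n. Qed.

(** The product has two slots: [f] in the first gives the last term of the Hochschild differential,
    [f] in the second gives the first term, with the sign of an insertion of degree [q] at place
    1. *)
Lemma hom_circ_mull q s (f : Defs.Hom A q.+1 s s) (e : (1 + q = q.+1)%N) :
  hom_circ e (mul_hom A s) f = hoch_r idfun f + (-1) ^+ q *: hoch_l idfun f.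
Proof.
rewrite /hom_circ 2!big_ord_recl big_ord0 addr0 muln0 expr0 scale1r /= muln1.
congr (_ + _ *: _); apply: mlin_ext => b; rewrite hom_insertE /=.
  congr (amul s (mfun f _) (b _)).
    apply: functional_extensionality_dep => j; congr (b _).
    by apply: ord_inj; rewrite inordK // add0n ltnS ltnW.
  by apply: ord_inj; rewrite inordK.
congr (amul s (b _) (mfun f _)).
  by apply: ord_inj; rewrite inordK.
apply: functional_extensionality_dep => j; congr (b _).
by apply: ord_inj; rewrite inordK // ltnS.
Qed.

Lemma hochE s t (h : {linear A s -> A t}) q (f : Defs.Hom A q.+1 s t) :
  hoch h f = hoch_l h f - \sum_(i < q.+1) (-1) ^+ i *: hoch_m i f
             + (-1) ^+ q *: hoch_r h f.
Proof.
rewrite /hoch !exprS mulN1r mulN1r opprK -sumrN.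
by congr (_ + _ + _); apply: eq_bigr => i _; rewrite exprS mulN1r scaleNr.
Qed.

Lemma hom_circ_mul_hoch q s (f : Defs.Hom A q.+1 s s) (e : (1 + q = q.+1)%N)
    (e' : (q + 1 = q.+1)%N) :
  hom_circ e (mul_hom A s) f - (-1) ^+ q *: hom_circ e' f (mul_hom A s) =
  (-1) ^+ q *: hoch idfun f.
Proof.
rewrite hom_circ_mull hom_circ_mulr hochE !scalerDr scalerN scalerA -expr2 sqrr_sign scale1r.
by rewrite [X in X + _]addrC -!addrA; congr (_ + _); rewrite addrC.
Qed.

(** M lives in degree 1 alone, which leaves one summand; the two proofs of the degree equation agree
    by proof irrelevance on [nat]. *)
Lemma bracketM (g : fam (g_ A)) q :
  bracket (of_gt (M A)) g q.+1 =
  bracket_ (add1n q) (gt_in_g (M A 1)) (g q).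
Proof.
rewrite /bracket (bigD1 (lift ord0 ord0)) //= big1 ?addr0.
  move: (subnKC _); rewrite /of_gt /=.
  by rewrite (subn1 q.+1) /= => e; congr bracket_; exact: eq_irrelevance.
case=> [[|[|m]] Hm] //= _; rewrite /of_gt /= gt_in_g0; exact: bracket_0l.
Qed.

Lemma bracketM0 (g : fam (g_ A)) : bracket (of_gt (M A)) g 0%N = 0.
Proof. by rewrite /bracket big_ord1 /of_gt /= gt_in_g0 bracket_0l. Qed.

Lemma bracketM_gt (x : fam (gt_ A)) q :
  bracket (of_gt (M A)) (of_gt x) q.+1 =
  (-1) ^+ q *: gt_in_g (dH (x q : C A 0 q.+1)).
Proof.
rewrite bracketM /bracket_ !circE mul1n.
have E w t : circ_sum (add1n q) (gt_in_g (M A 1)) (of_gt x q) w t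
    - (-1) ^+ q *: circ_sum (etrans (addnC q 1) (add1n q)) (of_gt x q)
        (gt_in_g (M A 1)) w t
    = (-1) ^+ q *: spread (hoch idfun (gt_part (x q) t)) w.
  rewrite !circ_sum_gt -[RHS]spreadZ.
  rewrite -(hom_circ_mul_hoch _ (add1n q) (etrans (addnC q 1) (add1n q))).
  (* [gt_part (M A 1) t] reduces to the product of A_t only once [t] is known. *)
  by apply: mlin_ext => b; case: t.
by congr (_, _, _); [apply: functional_extensionality_dep => w; exact: E
  |rewrite [LHS]E spread_id|rewrite [LHS]E spread_id].
Qed.

End BracketM.

(** * Bracketing with Phi *)

Section ExpPhi.
Variables (K : fieldType) (A : diagram K).

(** Phi has degree 0, so only the last summand remains and the sign of the commutator is 1. *)
Lemma adPhi_deg (f : fam (g_ A)) k :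
  adPhi f k = circ (addn0 k) (f k) (a_in_g (Phi A 0))
              - circ (add0n k) (a_in_g (Phi A 0)) (f k).
Proof.
rewrite /adPhi /bracket big_ord_recr /= big1 ?add0r.
  move: (subnKC _); rewrite /of_a subnn => e.
  rewrite /bracket_ muln0 expr0 scale1r.
  by congr (_ - _); congr circ; exact: eq_irrelevance.
move=> m _; move: (subnKC _); rewrite /of_a.
case E: (k - m)%N => [|n] e; last by rewrite a_in_g0 bracket_0r.
by move: (ltn_ord m); rewrite -subn_gt0 E.
Qed.

(** All components of Phi have target A_W, so the letter at the place of insertion becomes W. *)
Lemma circ_sum_Phir k (f : g_ A k) w t x :
  mfun (circ_sum (addn0 k) f (a_in_g (Phi A 0)) w t) x =
  \sum_(i < k.+1)
    mfun (component f (outer 0 w i objW) t) (outer_args x (push (x i))).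
Proof.
rewrite mlin_sumE; apply: eq_bigr => i _.
rewrite mul0n expr0 scale1r circ_atE sum_obj.
rewrite (@component_a0 _ _ _ _ _ objU) // (@component_a0 _ _ _ _ _ objV) //.
rewrite !mlin0E [X in X + _ + _](@mlin_arg0 _ _ _ _ _ _ _ i) ?outer_args_at0 //.
rewrite [X in _ + X + _](@mlin_arg0 _ _ _ _ _ _ _ i) ?outer_args_at0 // !add0r.
congr (mfun _ (outer_args x _)); rewrite -[LHS]/(push (x (inord (i + 0)))).
by rewrite addn0 inord_val.
Qed.

Lemma circ_sum_Phil k (f : g_ A k) w x :
  mfun (circ_sum (add0n k) (a_in_g (Phi A 0)) f w objW) x =
  phi (mfun (spread f.1.2 w) x) + psi (mfun (spread f.2 w) x).
Proof.
have inner0 s (g : Defs.Hom A k.+1 s s) :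
    mfun (spread g (inner k w 0)) (inner_args 0 x) = mfun (spread g w) x.
  rewrite !spreadE; congr (mfun g _); apply: functional_extensionality_dep => j.
  by rewrite /inner_args /inner add0n inord_val.
rewrite mlin_sumE big_ord1 muln0 expr0 scale1r circ_atE sum_obj.
have E s (y : A s) : mfun (component (a_in_g (Phi A 0)) (outer k w ord0 s) objW)
    (outer_args x y) = push y.
  rewrite -[LHS]/(push (outer_args x y ord0)).
  by rewrite (outer_argsE (fun u => @push K A u)).
by rewrite !E pushW addr0 pushU pushV -(inner0 objU) -(inner0 objV).
Qed.

Lemma adPhiW (f : fam (g_ A)) k w x :
  mfun ((adPhi f k).1.1 w) x =
  \sum_(i < k.+1)
     mfun ((f k).1.1 (outer 0 w i objW)) (outer_args x (push (x i)))
  - (phi (mfun (spread (f k).1.2 w) x) + psi (mfun (spread (f k).2 w) x)).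
Proof.
by rewrite adPhi_deg !circE -[RHS]/(_ - _) -circ_sum_Phir -circ_sum_Phil.
Qed.

(** Inserting Phi requires an input in A_W, which a map on A_U alone does not have, and Phi composed
    with anything lands in A_W. *)
Lemma adPhiU (f : fam (g_ A)) k : (adPhi f k).1.2 = 0.
Proof.
rewrite adPhi_deg !circE /=; apply: mlin_ext => x.
rewrite mlinDE mlinNE circ_sum_Phir big1 => [|i _]; last first.
  by rewrite (@spread_neq _ _ _ _ _ _ _ _ i) // outer0E eqxx.
rewrite mlin_sumE big1 ?subrr // => i _.
by rewrite mlinZE circ_atE big1 ?scaler0.
Qed.

Lemma adPhiV (f : fam (g_ A)) k : (adPhi f k).2 = 0.
Proof.
rewrite adPhi_deg !circE /=; apply: mlin_ext => x.
rewrite mlinDE mlinNE circ_sum_Phir big1 => [|i _]; last first.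
  by rewrite (@spread_neq _ _ _ _ _ _ _ _ i) // outer0E eqxx.
rewrite mlin_sumE big1 ?subrr // => i _.
by rewrite mlinZE circ_atE big1 ?scaler0.
Qed.

Lemma g_ext k (f g : g_ A k) : (forall w x, mfun (f.1.1 w) x = mfun (g.1.1 w) x) ->
  f.1.2 = g.1.2 -> f.2 = g.2 -> f = g.
Proof.
case: f g => [[f1 f2] f3] [[g1 g2] g3] /= E -> ->; congr (_, _, _).
by apply: functional_extensionality_dep => w; apply: mlin_ext.
Qed.

Lemma adPhiD (f g : fam (g_ A)) : adPhi (f + g) = adPhi f + adPhi g.
Proof.
apply: functional_extensionality_dep => k; apply: g_ext => [w x||].
- rewrite -[RHS]/(mfun ((adPhi f k).1.1 w) x + mfun ((adPhi g k).1.1 w) x).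
  rewrite !adPhiW addrACA -opprD -big_split [in X in _ = _ - X]addrACA.
  by rewrite -!linearD.
- by rewrite -[RHS]/((adPhi f k).1.2 + (adPhi g k).1.2) !adPhiU addr0.
- by rewrite -[RHS]/((adPhi f k).2 + (adPhi g k).2) !adPhiV addr0.
Qed.

Lemma iter_adPhiD j (f g : fam (g_ A)) :
  iter j (@adPhi K A) (f + g) = iter j (@adPhi K A) f + iter j (@adPhi K A) g.
Proof. by elim: j => //= j ->; rewrite adPhiD. Qed.

(** * Vanishing of iterates by counting letters W *)

Definition isW s := if s is objW then true else false.

Lemma isWP s : reflect (s = objW) (isW s).
Proof. by case: s => /=; constructor. Qed.

Definition count_W n (w : word n) : nat := (\sum_(i < n) isW (w i))%N.

Lemma count_W_outer k (w : word k.+1) i : w i <> objW ->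
  count_W (outer 0 w i objW) = (count_W w).+1.
Proof.
move=> wi; rewrite /count_W (bigD1 i) //= [in RHS](bigD1 i) //= outer0E eqxx.
have -> : isW (w i) = false by apply/isWP.
rewrite add0n add1n; congr _.+1; apply: eq_bigr => j /negbTE ji.
by rewrite outer0E ji.
Qed.

(* Inserting Phi turns a letter other than W of the source word of f into the
   letter W, so it lowers the number of W's that a source word can have. *)
Definition W_lt c k (f : g_ A k) :=
  [/\ forall w x, (c <= count_W w)%N -> mfun (f.1.1 w) x = 0, f.1.2 = 0 & f.2 = 0].

(** With zero U and V components the term with Phi outside drops out, and so do the places with
    letter W, where [push] is zero. *)
Lemma adPhiW0 (f : fam (g_ A)) k w x : (f k).1.2 = 0 -> (f k).2 = 0 ->
  mfun ((adPhi f k).1.1 w) x =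
  \sum_(i < k.+1 | ~~ isW (w i))
     mfun ((f k).1.1 (outer 0 w i objW)) (outer_args x (push (x i))).
Proof.
move=> fU fV; rewrite adPhiW fU fV !spread0 !mlin0E !linear0 addr0 subr0.
rewrite [RHS]big_mkcond; apply: eq_bigr => i _; case: isWP => //= wi.
by rewrite (@mlin_arg0 _ _ _ _ _ _ _ i) // push0 // outer_args_at0.
Qed.

Lemma W_lt_adPhi c (f : fam (g_ A)) k : W_lt c.+1 (f k) -> W_lt c (adPhi f k).
Proof.
case=> fW fU fV; split; [|exact: adPhiU|exact: adPhiV] => w x cw.
rewrite adPhiW0 // big1 // => i /isWP wi.
by rewrite fW // count_W_outer.
Qed.

Lemma W_lt_iter c j (f : fam (g_ A)) k : W_lt c (f k) ->
  W_lt (c - j) (iter j (@adPhi K A) f k).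
Proof.
move=> fc; elim: j => [|j IHj]; first by rewrite subn0.
(* The bound [c - j] is weakened to [(c - j.+1).+1]; the two differ once truncated subtraction has
   reached 0. *)
apply: W_lt_adPhi; case: IHj => fW fU fV; split=> // w x cw; apply: fW.
by rewrite (leq_trans _ cw) // subnS leqSpred.
Qed.

Lemma iter_adPhi_eq0 c j (f : fam (g_ A)) k : W_lt c (f k) -> (c <= j)%N ->
  iter j (@adPhi K A) f k = 0.
Proof.
move=> /(@W_lt_iter c j) /[swap]; rewrite -subn_eq0 => /eqP -> [fW fU fV].
by apply: g_ext => // w x; rewrite fW.
Qed.

End ExpPhi.

(** * The exponential of Phi, evaluated on g~ *)

Section ExpPhiGt.
Variables (K : fieldType) (A : diagram K).

Lemma expPhi_sum N (f : fam (g_ A)) k :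
  (forall j, (N <= j)%N -> iter j (@adPhi K A) f k = 0) ->
  expPhi f k = \sum_(j < N) (j`!%:R : K)^-1 *: iter j (@adPhi K A) f k.
Proof.
move=> f0; rewrite /expPhi (@fsbigE _ _ _ _ _ (iota 0 N)) ?iota_uniq //; last first.
  by move=> j _; rewrite mem_iota add0n -leqNgt => /f0 ->; rewrite scaler0.
rewrite -(big_mkord predT (fun j => (j`!%:R : K)^-1 *: iter j (@adPhi K A) f k)).
by rewrite /index_iota subn0; apply: eq_bigl => j; rewrite in_setT.
Qed.

Lemma count_W_le n (w : word n) : (count_W w <= n)%N.
Proof.
rewrite /count_W -[leqRHS]card_ord -sum1_card; apply: leq_sum => i _; exact: leq_b1.
Qed.

(** A bound uniform in [f]: the first bracket removes the U and V components, a word of length k+1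
    has fewer than k+2 letters W, and k+2 further brackets lower this bound to 0. *)
Lemma iter_adPhi_big (f : fam (g_ A)) k j : (k.+3 <= j)%N ->
  iter j (@adPhi K A) f k = 0.
Proof.
case: j => // j kj; rewrite iterSr; apply: (@iter_adPhi_eq0 _ _ k.+2) => //.
split; [|exact: adPhiU|exact: adPhiV] => w x.
by rewrite leqNgt ltnS count_W_le.
Qed.

Lemma expPhiD (f g : fam (g_ A)) : expPhi (f + g) = expPhi f + expPhi g.
Proof.
apply: functional_extensionality_dep => k; rewrite -[RHS]/(expPhi f k + expPhi g k).
rewrite !(@expPhi_sum k.+3) -?big_split /=; try exact: iter_adPhi_big.
by apply: eq_bigr => j _; rewrite iter_adPhiD -scalerDr.
Qed.

Lemma count_W_lt n (w : word n) i : w i <> objW -> (count_W w < n)%N.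
Proof.
by case: n w i => [|n] w i wi; [case: i wi|rewrite -(count_W_outer wi) count_W_le].
Qed.

Lemma count_W_full n (w : word n) : (forall i, isW (w i)) -> count_W w = n.
Proof.
by move=> wW; rewrite -[RHS]card_ord -sum1_card; apply: eq_bigr => i _; rewrite wW.
Qed.

Lemma count_W_compl n (w : word n) : (#|[pred i | ~~ isW (w i)]| + count_W w = n)%N.
Proof.
rewrite -[in RHS](card_ord n) -sum1_card -sum1_card big_mkcond -big_split.
by apply: eq_bigr => i _; rewrite inE; case: (isW _).
Qed.

Definition phi_psi_comp (x : fam (gt_ A)) k (w : word k.+1) (y : args A w) : A objW :=
  phi (mfun (spread (x k).1.1 w) y) + psi (mfun (spread (x k).1.2 w) y).

(** Induction on [j]: each letter other than W may be the one replaced last, so j+1 equal summands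
    turn j! into (j+1)!. The term with Phi outside arises at the first bracket and vanishes on words
    containing W, hence does not survive the second. *)
Lemma iter_adPhi_gt (x : fam (gt_ A)) k j w y :
  mfun ((iter j (@adPhi K A) (of_gt x) k).1.1 w) y =
  mfun (x k).2 (fun i => toW (y i)) *+ ((j + count_W w == k.+1) * j`!)%N
  - phi_psi_comp x y *+ (j == 1).
Proof.
elim: j => [|j IHj] in w y *.
  rewrite add0n muln1 mulr0n subr0 -[LHS]/(mfun (spread (x k).2 w) y).
  (* If some letter is not W, the extension by zero of x_W vanishes and the count is too small;
     otherwise [toW] is the identity on every argument. *)
  have [i /isWP wi|wW] := pickP (fun i => ~~ isW (w i)).
    by rewrite (spread_neq _ _ wi) ltn_eqF // (count_W_lt wi).
  rewrite count_W_full => [|i]; last by rewrite -[isW _]negbK wW.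
  rewrite eqxx spreadE; congr (mfun _ _); apply: functional_extensionality_dep => i.
  by rewrite /toW push0 ?addr0 //; apply/isWP; rewrite -[isW _]negbK wW.
pose S := \sum_(i < k.+1) mfun ((iter j (@adPhi K A) (of_gt x) k).1.1
  (outer 0 w i objW)) (outer_args y (push (y i))).
have SE : S = mfun (x k).2 (fun i => toW (y i))
              *+ ((j.+1 + count_W w == k.+1) * (j.+1)`!)%N.
  rewrite (_ : S = \sum_(i < k.+1 | ~~ isW (w i)) mfun (x k).2 (fun i => toW (y i))
                     *+ ((j.+1 + count_W w == k.+1) * j`!)%N).
    (* The equal summands are indexed by the letters other than W; there are [j.+1] of them whenever
       the condition on the count holds. *)
    rewrite sumr_const -mulrnA factS; congr (_ *+ _).
    case: eqP => [jk|]; last by rewrite !mul0n.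
    rewrite !mul1n mulnC; congr (_ * _)%N; apply/(@addIn (count_W w)).
    by rewrite jk -[RHS](count_W_compl w).
  rewrite [RHS]big_mkcond; apply: eq_bigr => i _; rewrite IHj.
  (* The correction from the previous bracket vanishes, as the word now has a W at place [i]. *)
  have s0 s (g : Defs.Hom A k.+1 s s) : s <> objW ->
      mfun (spread g (outer 0 w i objW)) (outer_args y (push (y i))) = 0.
    by move=> sW; rewrite (@spread_neq _ _ _ _ _ _ _ _ i) // outer0E eqxx => /esym.
  rewrite /phi_psi_comp !s0 // !linear0 addr0 mul0rn subr0.
  case: isWP => [wi|wi] /=.
    rewrite (@mlin_arg0 _ _ _ _ _ _ _ i) ?mul0rn //.
    by rewrite (outer_args0E (fun u => @toW K A u)) eqxx push0 // toW_W.
  rewrite count_W_outer // addnS -addSn; congr (mfun _ _ *+ _).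
  apply: functional_extensionality_dep => l.
  rewrite (outer_args0E (fun u => @toW K A u)) toW_W; case: eqP => // ->.
  by rewrite toW_push.
rewrite iterS; case: j => [|j] in IHj S SE *.
  by rewrite adPhiW -SE mulr1n.
by rewrite adPhiW -SE /= adPhiU adPhiV !mlin0E !linear0 !addr0 ?subr0.
Qed.

Lemma expPhi_gt (charK : [pchar K] =i pred0) (x : fam (gt_ A)) k s y : s <> objW ->
  mfun ((expPhi (of_gt x) k).1.1 (fun=> s)) y =
  mfun (x k).2 (fun i => toW (y i)) - phi_psi_comp x y.
Proof.
move=> sW; rewrite (@expPhi_sum k.+3); last exact: iter_adPhi_big.
pose ev (f : g_ A k) := mfun (f.1.1 (fun=> s)) y.
rewrite -[LHS]/(ev _) (big_morph ev (id1 := 0) (op1 := +%R)) //.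
under eq_bigr => j _.
  rewrite -[ev _]/((j`!%:R)^-1 *: mfun ((iter j (@adPhi K A) (of_gt x) k).1.1 (fun=> s)) y).
  rewrite iter_adPhi_gt (_ : count_W _ = 0%N); last first.
    by rewrite /count_W big1 // => i _; case: s sW y @ev.
  rewrite addn0 scalerBr.
  over.
(* Characteristic 0 makes the factorials invertible. *)
have fact_neq0 j : (j`!%:R : K) != 0.
  by rewrite (iffLR (pcharf0P K) charK) -lt0n fact_gt0.
(* The two parts are summed separately: as the word has no W, x_W survives only at j = k+1, the
   correction only at j = 1. These indices coincide for k = 0. *)
rewrite big_split /= (bigD1 (Ordinal (ltnW (ltnSn k.+2)))) //= big1 => [|j jk].
  rewrite (bigD1 (Ordinal (isT : 1 < k.+3)%N)) //= [X in _ + (_ + X)]big1 => [|j j1].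
    rewrite eqxx mul1n -scaler_nat scalerA mulVf // invr1 !scale1r mulr1n addr0.
    by rewrite addr0.
  by rewrite -(inj_eq val_inj) /= in j1; rewrite (negbTE j1) mulr0n scaler0 oppr0.
by rewrite -(inj_eq val_inj) /= in jk; rewrite (negbTE jk) mul0n mulr0n scaler0.
Qed.

End ExpPhiGt.

(** * The bracket of M with an element of a *)

Section BracketMa.
Variables (K : fieldType) (A : diagram K).

(** The value of [a] on the k+1 consecutive arguments from place [p] on; it vanishes unless their
    letters are all U or all V. *)
Definition eval_a k (a : a_ A k) n (w : word n.+1) (x : args A w) p : A objW :=
  mfun a.1 (fun l => ext0 objU (x (inord (p + l)))) +
  mfun a.2 (fun l => ext0 objV (x (inord (p + l)))).

Lemma circ_at_Ma k n (e : (1 + k = n)%N) (a : a_ A k) i (w : word n.+1) x :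
  mfun (circ_at e (gt_in_g (M A 1)) (a_in_g a) i w objW) x =
  mfun (spread (mul_hom A objW) (outer k w i objW)) (outer_args x (eval_a a x i)).
Proof.
rewrite circ_atE sum_obj (@component_a0 _ _ _ _ _ objU) //.
rewrite (@component_a0 _ _ _ _ _ objV) // !component_gt !mlin0E.
rewrite [X in X + _ + _](@mlin_arg0 _ _ _ _ _ _ _ i) ?outer_args_at0 //.
by rewrite [X in _ + X + _](@mlin_arg0 _ _ _ _ _ _ _ i) ?outer_args_at0 // !add0r.
Qed.

Lemma circ_sum_Ma k (a : a_ A k) (w : word k.+2) x :
  mfun (circ_sum (add1n k) (gt_in_g (M A 1)) (a_in_g a) w objW) x =
  amul objW (eval_a a x 0) (ext0 objW (x ord_max)) +
  (-1) ^+ k *: amul objW (ext0 objW (x ord0)) (eval_a a x 1).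
Proof.
rewrite mlin_sumE 2!big_ord_recl big_ord0 addr0 !mlinZE !circ_at_Ma !spreadE.
rewrite /= !(outer_argsE (fun u => @ext0 K A u objW)) /= muln0 expr0 scale1r muln1.
have -> : inord (1 + k) = ord_max :> 'I_k.+2 by apply: ord_inj; rewrite inordK.
have -> // : inord 0 = ord0 :> 'I_k.+2 by apply: ord_inj; rewrite inordK.
Qed.

(** Products in A_U fit only into [a.1], those in A_V only into [a.2], and those in A_W into
    neither. *)
Lemma circ_at_aM k (a : a_ A k) (e : (k + 1 = k.+1)%N) i (w : word k.+2) :
  circ_at e (a_in_g a) (gt_in_g (M A 1)) i w objW =
  spread (hoch_m i a.1) w + spread (hoch_m i a.2) w.
Proof.
rewrite /circ_at sum_obj !component_aW !insertDl !component_gt.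
rewrite (insert_spread e a.1 (gt_part (M A 1) objU)) (insert_spread e a.2 (gt_part (M A 1) objV)).
rewrite !hom_insert_mul !insert_spread_neq // !addr0 add0r //.
Qed.

Lemma circ_sum_aM k (a : a_ A k) (e : (k + 1 = k.+1)%N) (w : word k.+2) :
  circ_sum e (a_in_g a) (gt_in_g (M A 1)) w objW =
  spread (\sum_(i < k.+1) (-1) ^+ i *: hoch_m i a.1) w +
  spread (\sum_(i < k.+1) (-1) ^+ i *: hoch_m i a.2) w.
Proof.
rewrite !spread_sum -big_split; apply: eq_bigr => i _.
by rewrite circ_at_aM mul1n scalerDr !spreadZ.
Qed.

Definition bracketMa (a : fam (a_ A)) := bracket (of_gt (M A)) (of_a a).

Lemma bracketMaW (a : fam (a_ A)) k w x :
  mfun ((bracketMa a k.+1).1.1 w) x =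
  amul objW (eval_a (a k) x 0) (ext0 objW (x ord_max)) +
  (-1) ^+ k *: amul objW (ext0 objW (x ord0)) (eval_a (a k) x 1) -
  (-1) ^+ k *: (mfun (spread (\sum_(i < k.+1) (-1) ^+ i *: hoch_m i (a k).1) w) x
              + mfun (spread (\sum_(i < k.+1) (-1) ^+ i *: hoch_m i (a k).2) w) x).
Proof.
rewrite /bracketMa bracketM /bracket_ !circE mul1n -circ_sum_Ma -mlinDE.
by rewrite -(circ_sum_aM _ (etrans (addnC k 1) (add1n k))).
Qed.

Lemma circ_sum_Ma0 k (e : (1 + k = k.+1)%N) (a : a_ A k) t : t <> objW ->
  circ_sum e (gt_in_g (M A 1)) (a_in_g a) (fun=> t) t = 0.
Proof.
move=> tW; apply: mlin_ext => x; rewrite mlin_sumE big1 // => i _.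
rewrite mlinZE circ_atE sum_obj (@component_a0 _ _ _ _ _ objU) //.
rewrite (@component_a0 _ _ _ _ _ objV) // !component_gt !mlin0E.
rewrite [X in X + _ + _](@mlin_arg0 _ _ _ _ _ _ _ i) ?outer_args_at0 //.
rewrite [X in _ + X + _](@mlin_arg0 _ _ _ _ _ _ _ i) ?outer_args_at0 // !add0r.
rewrite (@spread_neq _ _ _ _ _ _ _ _ i) ?scaler0 //.
by rewrite /outer ltnn eqxx => /esym.
Qed.

Lemma circ_sum_aM0 k (e : (k + 1 = k.+1)%N) (a : a_ A k) t : t <> objW ->
  circ_sum e (a_in_g a) (gt_in_g (M A 1)) (fun=> t) t = 0.
Proof.
move=> tW; apply: mlin_ext => x; rewrite mlin_sumE big1 // => i _.
by rewrite mlinZE circ_atE big1 ?scaler0 // => s _; rewrite component_a0.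
Qed.

Lemma bracketMaU (a : fam (a_ A)) k : (bracketMa a k).1.2 = 0.
Proof.
case: k => [|k]; first by rewrite /bracketMa bracketM0.
rewrite /bracketMa bracketM /bracket_ !circE.
rewrite !circ_sum_Ma0 // !circ_sum_aM0 //.
by rewrite -[LHS]/(0 - (-1) ^+ (1 * k) *: 0) scaler0 subr0.
Qed.

Lemma bracketMaV (a : fam (a_ A)) k : (bracketMa a k).2 = 0.
Proof.
case: k => [|k]; first by rewrite /bracketMa bracketM0.
rewrite /bracketMa bracketM /bracket_ !circE.
rewrite !circ_sum_Ma0 // !circ_sum_aM0 //.
by rewrite -[LHS]/(0 - (-1) ^+ (1 * k) *: 0) scaler0 subr0.
Qed.

Lemma count_W_ge2 n (w : word n) i : (2 <= count_W w)%N -> exists2 j, j != i & w j = objW.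
Proof.
move=> w2; have [j /andP[ji /isWP wj]|nW] := pickP (fun j => (j != i) && isW (w j)).
  by exists j.
move: w2; rewrite /count_W (bigD1 i) //= big1 => [|j ji].
  by rewrite addn0 ltnNge leq_b1.
by have := nW j; rewrite ji /= => ->.
Qed.

Lemma eval_a0 k (a : a_ A k) n (w : word n.+1) (x : args A w) p (l : 'I_k.+1) :
  w (inord (p + l)) = objW -> eval_a a x p = 0.
Proof.
move=> wW; rewrite /eval_a !(@mlin_arg0 _ _ _ _ _ _ _ l) ?addr0 //.
  by rewrite ext0_neq // wW.
by rewrite ext0_neq // wW.
Qed.

(** A product in A_W has one factor taken from A_W and the other produced by [a] from A_U or A_V;
    the remaining terms have no input in A_W at all. *)
Lemma W_lt_Ma (a : fam (a_ A)) k : W_lt 2 (bracketMa a k.+1).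
Proof.
split; [|exact: bracketMaU|exact: bracketMaV] => w x w2; rewrite bracketMaW.
have [i _ wi] := count_W_ge2 ord0 w2.
rewrite (spread_neq _ _ (i := i)) ?wi // (spread_neq _ _ (i := i)) ?wi //.
(* A letter W other than the last is an input of [a] in the first product; below, a letter W other
   than the first is one in the second product. *)
have [j jmax wj] := count_W_ge2 ord_max w2.
have jk : (j < k.+1)%N.
  by rewrite ltn_neqAle -ltnS ltn_ord andbT; apply: contra jmax => /eqP jk; apply/eqP/ord_inj.
rewrite (@eval_a0 _ _ _ _ _ 0 (Ordinal jk)) ?add0n ?inord_val //.
have [l l0 wl] := count_W_ge2 ord0 w2.
case: (unliftP ord0 l) l0 wl => [l' -> _ wl|->]; last by rewrite eqxx.
rewrite (@eval_a0 _ _ _ _ _ 1 l'); last first.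
  by rewrite -[RHS]wl; congr w; apply: ord_inj; rewrite inordK // ltnS.
by rewrite linear0l linear0r addr0 !scaler0 addr0 subr0.
Qed.

End BracketMa.

(** * Projection to a and the formula for the unary bracket *)

Section UnaryBracket.
Variables (K : fieldType) (A : diagram K).

Lemma P_Phi_gt (charK : [pchar K] =i pred0) (x : fam (gt_ A)) :
  P_Phi (of_gt x) = dDelta_gt x.
Proof.
apply: functional_extensionality_dep => k; rewrite /P_Phi /P /proj_a /dDelta_gt /=.
congr (_, _); apply: mlin_ext => y; rewrite expPhi_gt // mlinDE mlinNE /phi_psi_comp.
  rewrite [X in _ - (_ + psi X)](@spread_neq _ _ _ _ _ _ _ _ ord0) // linear0 addr0.
  rewrite spread_id; congr (mfun _ _ - _).
  by apply: functional_extensionality_dep => i; rewrite toW_push // pushU.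
rewrite [X in _ - (phi X + _)](@spread_neq _ _ _ _ _ _ _ _ ord0) // linear0 add0r.
rewrite spread_id; congr (mfun _ _ - _).
by apply: functional_extensionality_dep => i; rewrite toW_push // pushV.
Qed.

Lemma eval_a_const k (a : a_ A k) s n (y : args A (fun _ : 'I_n.+1 => s)) p :
  eval_a a y p = mfun (a_part a s) (fun l => y (inord (p + l))).
Proof.
rewrite /eval_a; case: s y => y /=.
- by rewrite [X in _ + X](@mlin_arg0 _ _ _ _ _ _ _ ord0) ?addr0.
- by rewrite [X in X + _](@mlin_arg0 _ _ _ _ _ _ _ ord0) ?add0r.
- by rewrite !(@mlin_arg0 _ _ _ _ _ _ _ ord0) ?add0r.
Qed.

Lemma eval_a_outer k (a : a_ A k) n (w : word n.+1) (x : args A w) p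
    (i : 'I_n.+1) s (u : A s) :
  (forall l : 'I_k.+1, inord (p + l) != i) ->
  @eval_a _ _ _ a _ (outer 0 w i s) (outer_args x u) p = eval_a a x p.
Proof.
move=> pi; rewrite /eval_a; congr (_ + _); congr (mfun _ _);
  apply: functional_extensionality_dep => l.
  by rewrite (outer_args0E (fun v => @ext0 K A v objU)) (negbTE (pi l)).
by rewrite (outer_args0E (fun v => @ext0 K A v objV)) (negbTE (pi l)).
Qed.

(** On a word without W the inserted Phi must supply the factor in A_W: the last place serves one
    product, the first place the other. Terms applying [a] to a product vanish once a letter is
    W. *)
Lemma adPhi_Ma (a : fam (a_ A)) k s (y : args A (fun _ : 'I_k.+2 => s)) :
  s <> objW ->
  mfun ((adPhi (bracketMa a) k.+1).1.1 (fun=> s)) y =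
  amul objW (mfun (a_part (a k) s) (ainit y)) (push (y ord_max)) +
  (-1) ^+ k *: amul objW (push (y ord0)) (mfun (a_part (a k) s) (atail y)).
Proof.
move=> sW; rewrite adPhiW0 ?bracketMaU ?bracketMaV // (eq_bigl predT) => [|i]; last first.
  exact/isWP.
under eq_bigr => i _.
  rewrite bracketMaW !(@spread_neq _ _ _ _ _ _ _ _ i); last 2 first.
  - by rewrite outer0E eqxx.
  - by rewrite outer0E eqxx.
  rewrite addr0 scaler0 subr0 !(outer_args0E (fun v => @ext0 K A v objW)).
  over.
rewrite big_split /= (bigD1 ord_max) //= big1 => [|i /negbTE im]; last first.
  by rewrite eq_sym im ext0_neq // linear0r.
rewrite (bigD1 ord0) //= [X in _ + (_ + X)]big1 => [|i /negbTE i0]; last first.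
  by rewrite eq_sym i0 ext0_neq // linear0l scaler0.
rewrite !eqxx !addr0 !eval_a_outer.
- rewrite !eval_a_const; congr (_ + _ *: _).
    congr (amul objW (mfun _ _) _); apply: functional_extensionality_dep => l; congr (y _).
    by apply: ord_inj; rewrite add0n inordK // ltnS ltnW.
  congr (amul objW _ (mfun _ _)); apply: functional_extensionality_dep => l.
  by congr (y _); apply: ord_inj; rewrite lift0 inordK add1n // ltnS.
- by move=> l; apply/eqP => /(congr1 val) /=; rewrite inordK add1n // ltnS.
- move=> l; apply/eqP => /(congr1 val) /=; rewrite add0n inordK => [lk|].
    by move: (ltn_ord l); rewrite lk ltnn.
  by rewrite ltnS ltnW.
Qed.

Lemma bracketMa_const (a : fam (a_ A)) k s (y : args A (fun _ : 'I_k.+2 => s)) :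
  s <> objW ->
  mfun ((bracketMa a k.+1).1.1 (fun=> s)) y =
  - (-1) ^+ k *: mfun (\sum_(i < k.+1) (-1) ^+ i *: hoch_m i (a_part (a k) s)) y.
Proof.
move=> sW; rewrite bracketMaW !ext0_neq // linear0r linear0l scaler0 addr0 sub0r scaleNr.
congr (- (_ *: _)); case: s y sW => // y _.
  by rewrite spread_id [X in _ + X](@spread_neq _ _ _ _ _ _ _ _ ord0) ?addr0.
by rewrite spread_id [X in X + _](@spread_neq _ _ _ _ _ _ _ _ ord0) ?add0r.
Qed.

Lemma P_Phi_Ma0 (a : fam (a_ A)) : P_Phi (bracketMa a) 0%N = 0.
Proof.
rewrite /P_Phi /P (@expPhi_sum _ _ 0) ?big_ord0 // => j _.
apply: (@iter_adPhi_eq0 _ _ 0) => //; by split; rewrite /bracketMa bracketM0.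
Qed.

(** The bound 2 stops the series after j = 1, with both factorials 1. The map [h] stands for [phi]
    or [psi], so that U and V are treated together. *)
Lemma expPhi_Ma (a : fam (a_ A)) k s (h : {linear A s -> A objW}) y :
  s <> objW -> (forall u, h u = push u) ->
  mfun ((expPhi (bracketMa a) k.+1).1.1 (fun=> s)) y =
  mfun ((-1) ^+ k *: hoch h (a_part (a k) s)) y.
Proof.
move=> sW hE; rewrite (@expPhi_sum _ _ 2) => [|j]; last first.
  by apply: iter_adPhi_eq0; exact: W_lt_Ma.
set R := RHS; rewrite 2!big_ord_recl big_ord0 /= addr0 invr1 !scale1r.
rewrite -[LHS]/(mfun ((bracketMa a k.+1).1.1 (fun=> s)) y
  + mfun ((adPhi (bracketMa a) k.+1).1.1 (fun=> s)) y).
rewrite bracketMa_const // adPhi_Ma // /R hochE !scalerDr scalerN scalerA -expr2 sqrr_sign scale1r.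
rewrite !mlinE /= !hE scaleNr.
by rewrite [X in _ + X]addrC addrA [X in X + _]addrC.
Qed.

Lemma P_Phi_MaS (a : fam (a_ A)) k :
  P_Phi (bracketMa a) k.+1 = (-1) ^+ k *: dH (a k : C A 1 k.+1).
Proof.
congr (_, _); apply: mlin_ext => y.
  by apply: (@expPhi_Ma a k objU phi) => // u; rewrite pushU.
by apply: (@expPhi_Ma a k objV psi) => // u; rewrite pushV.
Qed.

Lemma hoch0 s t (h : {linear A s -> A t}) q : hoch h (0 : Defs.Hom A q.+1 s t) = 0.
Proof.
apply: mlin_ext => b; rewrite hochE !mlinE /= mlin_sumE big1 => [|i _].
  by rewrite linear0r linear0l scaler0 subr0 addr0.
by rewrite mlinZE scaler0.
Qed.

Lemma dH0_0 q : dH (0 : C A 0 q) = 0.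
Proof. by case: q => // q; congr (_, _, _); exact: hoch0. Qed.

Lemma dH1_0 q : dH (0 : C A 1 q) = 0.
Proof. by case: q => // q; congr (_, _); exact: hoch0. Qed.

Lemma dDelta_0 q : dDelta (0 : C A 0 q) = 0.
Proof.
case: q => // q; congr (_, _); apply: mlin_ext => b.
  by rewrite !mlinE /= linear0 subr0.
by rewrite !mlinE /= linear0 subr0.
Qed.

Lemma gt_in_gZ n c (x : gt_ A n) : gt_in_g (c *: x) = c *: gt_in_g x.
Proof.
by congr (_, _, _); apply: functional_extensionality_dep => w; exact: spreadZ.
Qed.

(** The brackets give signs in terms of the degree [k] of each component; by homogeneity [k] equals
    [m], respectively [n], or the component is zero. *)
Lemma unary_homog (charK : [pchar K] =i pred0) (m n : int)
    (x : fam (gt_ A)) (a : fam (a_ A)) : homog m x -> homog n a ->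
  unary (x, a) =
  L_in ((-1) ^ (m + 1) *: dH_gt x, dDelta_gt x + (-1) ^ n *: dH_a a).
Proof.
move=> xm an; rewrite /unary /L_in /=; congr (_, _).
  apply: functional_extensionality_dep => -[|k].
    rewrite -[LHS]/(- bracket (of_gt (M A)) (of_gt x) 0%N) bracketM0 oppr0.
    by rewrite -[RHS]/(gt_in_g (_ *: 0)) scaler0 gt_in_g0.
  rewrite -[LHS]/(- bracket (of_gt (M A)) (of_gt x) k.+1) bracketM_gt.
  rewrite -[RHS]/(gt_in_g ((-1) ^ (m + 1) *: dH (x k : C A 0 k.+1))).
  have [km|/eqP km] := eqVneq k%:Z m; last first.
    by rewrite xm // dH0_0 !gt_in_g0 scaler0 oppr0 scaler0 gt_in_g0.
  have -> : m + 1 = k.+1%:Z by lia.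
  by rewrite gt_in_gZ -exprnP exprS mulN1r scaleNr.
have PD f g : P_Phi (f + g) = P_Phi f + P_Phi g :> fam (a_ A).
  by rewrite /P_Phi expPhiD.
rewrite PD P_Phi_gt //; congr (_ + _); apply: functional_extensionality_dep => -[|k].
  by rewrite P_Phi_Ma0 -[RHS]/(_ *: 0) scaler0.
rewrite P_Phi_MaS -[RHS]/((-1) ^ n *: dH (a k : C A 1 k.+1)).
have [<-//|/eqP kn] := eqVneq k%:Z n.
by rewrite an // dH1_0 !scaler0.
Qed.

(** * Comparison with the Gerstenhaber-Schack complex *)

(** Bidegree (0, n+1) has N = n+1, and degree n in g~ becomes N-2 after the shift; bidegree (1, n+1)
    has N = n+2, and degree n in a is N-2 already. *)
Lemma ident_deg (N : int) (c : CGS A) : CGS_deg N c -> L_deg (N - 2) (ident c).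
Proof.
by move=> cN; split=> n nN; [apply: (cN 0%N n.+1)|apply: (cN 1%N n.+1)]; lia.
Qed.

Lemma zmod0_eq (u v : zmod0 K) : u = v.
Proof. by apply/matrixP => i []. Qed.

(** The bidegrees that [ident] forgets, q = 0 or p at least 2, carry the zero space. *)
Lemma CGS_ext (c c' : CGS A) : ident c = ident c' -> c = c'.
Proof.
case=> c0 c1; apply: functional_extensionality_dep => p.
apply: functional_extensionality_dep => -[|q].
  by case: p => [|[|p]]; exact: zmod0_eq.
case: p => [|[|p]]; last exact: zmod0_eq.
  by have := congr1 (fun f => f q) c0.
by have := congr1 (fun f => f q) c1.
Qed.

End UnaryBracket.

Theorem proposition4p9 (K : fieldType) (charK : [pchar K] =i pred0)
    (A : diagram K) :
  [/\ linear (@ident K A),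
      forall N : int,
        set_bij [set c | CGS_deg N c]%classic [set l | L_deg (N - 2) l]%classic
                (@ident K A),
      forall (N : int) (c : CGS A), CGS_deg N c ->
        unary (ident c) = L_in (ident ((-1) ^ N *: dGS c))
    & forall (m n : int) (x : fam (gt_ A)) (a : fam (a_ A)),
        homog m x -> homog n a ->
        unary (x, a) =
        L_in ((-1) ^ (m + 1) *: dH_gt x, dDelta_gt x + (-1) ^ n *: dH_a a)].
Proof.
split=> [//|N|N c cN|]; last exact: unary_homog.
  split=> [c /ident_deg //|c c' _ _|[x a] [xN aN]]; first exact: CGS_ext.
  (* The preimage is extended by zero to the bidegrees outside the image of the identification. *)
  pose c : CGS A := fun p => match p return fam (C A p) with
    | 0 => fun q => match q return C A 0 q with 0 => 0 | q'.+1 => x q' end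
    | 1 => fun q => match q return C A 1 q with 0 => 0 | q'.+1 => a q' end
    | p'.+2 => fun q => 0
    end.
  by exists c => // -[|[|p]] [|q] //= pqN; [apply: xN|apply: aN] => qN; apply: pqN; lia.
have [xN aN] := ident_deg cN.
rewrite (unary_homog charK xN aN); congr (L_in (_, _)).
  apply: functional_extensionality_dep => n.
  (* Before the shift [x] has degree N-1, so the exponent |x|+1 is [N]. *)
  rewrite (_ : N - 2 + 1 + 1 = N); last by lia.
  rewrite -[RHS]/((-1) ^ N *: (dH (c 0%N n) + 0)) addr0.
  by case: n => // ; congr (_ *: _).
apply: functional_extensionality_dep => n.
rewrite -[RHS]/((-1) ^ N *: (dH (c 1%N n) + (-1) ^+ n.+1 *: dDelta (c 0%N n.+1))).
rewrite -[LHS]/(dDelta (c 0%N n.+1) + (-1) ^ (N - 2) *: dH_a (ident c).2 n).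
rewrite scalerDr addrC; congr (_ + _).
  rewrite exprzDr ?unitrN1 // -[_ ^ (- 2)]/(((-1) ^+ 2)^-1) sqrrN expr1n invr1 mulr1.
  by case: n => // ; congr (_ *: _).
(* The sign (-1)^q of the simplicial part of [dGS], with q = n+1 = N, cancels the overall (-1)^N; in
   other degrees the component of [c] is zero. *)
have [nN|/eqP nN] := eqVneq n.+1%:Z N.
  by rewrite -nN -exprnP scalerA -expr2 sqrr_sign scale1r.
by rewrite [c 0%N n.+1]cN // dDelta_0 !scaler0.
Qed.
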